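(* Let $p$ be a prime, $q=p^\lambda$ with $\lambda\ge1$, and let $F$ be a field with $\mathbb F_q\subseteq F$. Let $\sigma$ be a permutation of $\{0,1,2,\ldots\}$ and let $\sigma_\ast$ be the induced automorphism of $F[x]\{\{\mathfrak D\}\}$. Then $\sigma_\ast$ stabilizes both $\mathfrak{BD}^\ast$ and $\mathfrak{BD}^\ast_{q,0}$, i.e. $\sigma_\ast(\mathfrak{BD}^\ast)=\mathfrak{BD}^\ast$ and $\sigma_\ast(\mathfrak{BD}^\ast_{q,0})=\mathfrak{BD}^\ast_{q,0}$.
   Context: $F[x]\{\{\mathfrak D\}\}$ is the commutative ring of formal series $\sum_{i\ge0}a_i\mathfrak D_i$ ($a_i\in F[x]$) with coefficientwise addition and multiplication $(\sum_i a_i\mathfrak D_i)(\sum_j b_j\mathfrak D_j)=\sum_n\big(\sum_{i=0}^n\binom ni a_ib_{n-i}\big)\mathfrak D_n$. For a permutation $\sigma$ of $\{0,1,2,\ldots\}$ and a nonnegative integer $i=\sum_t i_tq^t$ written $q$-adically ($0\le i_t<q$), put $\sigma_\ast i:=\sum_t i_tq^{\sigma(t)}$. The induced map $\sigma_\ast\big(\sum_i a_i\mathfrak D_i\big):=\sum_i a_i\mathfrak D_{\sigma_\ast i}$ is (known to be) a ring automorphism of $F[x]\{\{\mathfrak D\}\}$, since $F$ has characteristic $p$. A sequence $P=\{p_i(x)\}_{i=0}^\infty$ in $F[x]$ satisfies the Binomial Theorem if $p_n(x+y)=\sum_{i=0}^n \binom{n}{i}p_i(x)p_{n-i}(y)$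 for all $n\ge 0$; it is nontrivial if not all $p_i(x)$ are zero. Its generating function is $f_P(x)=\sum_{i\ge0}p_i(x)\mathfrak D_i$; $\mathfrak{BD}^\ast$ is the set of generating functions of nontrivial sequences satisfying the Binomial Theorem. A polynomial in $F[x]$ is $\mathbb F_q$-linear if it is a finite $F$-linear combination of monomials $x^{q^n}$, $n\ge0$. For a sequence $E=\{e_t(x)\}_{t=0}^\infty$ of $\mathbb F_q$-linear polynomials put $p_{E,i}(x):=\prod_t e_t(x)^{i_t}$ for $i=\sum_t i_tq^t$ ($0\le i_t<q$, $e^0=1$) and $P_E:=\{p_{E,i}(x)\}_{i=0}^\infty$. $\mathfrak{BD}^\ast_{q,0}$ is the set of all $f_{P_E}(x)$ for such $E$. *)

(* Defs.v *)
From HB Require Import structures.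
From mathcomp Require Import all_boot all_algebra.
From mathcomp Require Import boolp classical_sets functions cardinality fsbigop.

Set Implicit Arguments.
Unset Strict Implicit.
Unset Printing Implicit Defensive.

Import GRing.Theory.

Local Open Scope classical_set_scope.
Local Open Scope ring_scope.

(* The series \sum_i a_i D_i in F[x]{{D}} is represented by its coefficient
   sequence i |-> a_i. The alias keeps the product below apart from the
   pointwise product that MathComp puts on function types. *)
Definition dseries (F : fieldType) : Type := nat -> {poly F}.

Section DSeriesRing.
Variable F : fieldType.
Implicit Types a b c : dseries F.

HB.instance Definition _ := GRing.Zmodule.copy (dseries F) (nat -> {poly F}).

Definition dseries_mul a b : dseries F :=
  fun n => \sum_(i < n.+1) 'C(n, i)%:R * a i * b (n - i)%N.

Definition dseries_one : dseries F := fun n => (n == 0%N)%:R.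

Fact dseries_mulC : commutative dseries_mul.
Proof.
move=> a b; apply/funext => n; rewrite /dseries_mul.
rewrite (reindex_inj rev_ord_inj) /=; apply: eq_bigr => i _.
by rewrite subSS subKn -1?ltnS // bin_sub -1?ltnS // mulrAC.
Qed.

Fact dseries_mul1 : left_id dseries_one dseries_mul.
Proof.
move=> a; apply/funext => n; rewrite /dseries_mul big_ord_recl big1 => [|i _].
  by rewrite /dseries_one bin0 !mul1r subn0 addr0.
by rewrite /dseries_one mulr0 mul0r.
Qed.

Fact dseries_mulDl : left_distributive dseries_mul +%R.
Proof.
move=> a b c; apply/funext => n.
rewrite -[RHS]/(dseries_mul a c n + dseries_mul b c n) /dseries_mul -big_split /=.
by apply: eq_bigr => i _; rewrite -mulrDl -mulrDr.
Qed.

Fact dseries_one_neq0 : dseries_one != 0.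
Proof.
apply/eqP => /(congr1 (fun a : dseries F => a 0%N)) /eqP.
by rewrite /dseries_one [X in _ == X]/(0 : {poly F}) oner_eq0.
Qed.

Fact bin_trinomial n j k : (j + k <= n)%N ->
  ('C(n, j) * 'C(n - j, k) = 'C(n, k) * 'C(n - k, j))%N.
Proof.
move=> le_jk_n; have le_jn := leq_trans (leq_addr k j) le_jk_n.
have le_kn := leq_trans (leq_addl j k) le_jk_n.
have := bin_fact le_jn; rewrite -(bin_fact le_kn).
have -> : ((n - j)`! = 'C(n - j, k) * (k`! * (n - j - k)`!))%N.
  by rewrite bin_fact // leq_subRL.
have -> : ((n - k)`! = 'C(n - k, j) * (j`! * (n - j - k)`!))%N.
  by rewrite subnAC bin_fact // leq_subRL // addnC.
move=> E; apply/eqP.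
rewrite -(eqn_pmul2r (fact_gt0 j)) -(eqn_pmul2r (fact_gt0 k)).
rewrite -(eqn_pmul2r (fact_gt0 (n - j - k))).
have -> : ('C(n, j) * 'C(n - j, k) * j`! * k`! * (n - j - k)`! =
  'C(n, j) * (j`! * ('C(n - j, k) * (k`! * (n - j - k)`!))))%N.
  by rewrite -!mulnA; congr (_ * _)%N; rewrite mulnCA.
by rewrite E -!mulnA; apply/eqP; congr (_ * _)%N; rewrite !(mulnCA k`!).
Qed.

Fact dseries_mulA : associative dseries_mul.
Proof.
move=> a b c; rewrite [RHS]dseries_mulC (dseries_mulC b); apply/funext => n.
pose G i k := ('C(n, i) * 'C(n - i, k))%:R * (a i * (c k * b (n - i - k)%N)).
rewrite /dseries_mul.
transitivity (\sum_(i < n.+1) \sum_(k < n.+1 | (k <= n - i)%N) G i k).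
  apply: eq_bigr => i _; rewrite (big_ord_narrow_leq (leq_subr _ _)) /=.
  rewrite mulr_sumr; apply: eq_bigr => k _.
  by rewrite /G natrM -!mulrA; congr (_ * _); rewrite mulrCA.
rewrite (exchange_big_dep predT) //=; apply: eq_bigr => k _.
have leS (i j : 'I_n.+1) : (i <= n - j)%N = (j + i <= n)%N.
  by rewrite leq_subRL // -ltnS.
transitivity (\sum_(i < n.+1 | (i <= n - k)%N) G i k).
  by apply: eq_bigl => i; rewrite !leS addnC.
rewrite (big_ord_narrow_leq (leq_subr _ _)) /= mulr_sumr; apply: eq_bigr => i _.
rewrite /G bin_trinomial; last by rewrite addnC -leq_subRL -ltnS.
rewrite natrM -!mulrA; congr (_ * _).
by rewrite subnAC [RHS]mulrCA; congr (_ * _); rewrite mulrCA.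
Qed.

HB.instance Definition _ := GRing.Zmodule_isComNzRing.Build (dseries F)
  dseries_mulA dseries_mulC dseries_mul1 dseries_mulDl dseries_one_neq0.

End DSeriesRing.

Definition qdigit (q i t : nat) : nat := ((i %/ q ^ t) %% q)%N.

(* For q >= 2 one has i < q ^ i, so the digits of i at positions t >= i are 0
   and the range t < i below loses nothing. *)
Definition digit_perm (q : nat) (sigma : nat -> nat) (i : nat) : nat :=
  (\sum_(t < i) qdigit q i t * q ^ sigma t)%N.

(* The coefficient of D_n in \sum_i a_i D_{sigma_* i} collects the a_i with
   sigma_* i = n; there is exactly one such i when sigma is a permutation and
   q >= 2. *)
Definition dseries_perm (F : fieldType) (q : nat) (sigma : nat -> nat)
    (a : dseries F) : dseries F :=
  fun n => \sum_(i \in [set i | digit_perm q sigma i = n]) a i.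

(* An identity in F[x, y] = {poly {poly F}}: x is 'Y, i.e. 'X%:P, y is 'X, so
   p_i(x) is (p i)%:P and p_j(y) is map_poly polyC (p j). *)
Definition binomial_theorem (F : fieldType) (P : nat -> {poly F}) : Prop :=
  forall n, poly_XaY (P n) =
    \sum_(i < n.+1) 'C(n, i)%:R * (P i)%:P * map_poly polyC (P (n - i)%N).

Definition nontrivial (F : fieldType) (P : nat -> {poly F}) : Prop :=
  exists i, P i != 0.

Definition genfun (F : fieldType) (P : nat -> {poly F}) : dseries F :=
  fun i => P i.

Definition BD (F : fieldType) : set (dseries F) :=
  [set f | exists P : nat -> {poly F},
    [/\ binomial_theorem P, nontrivial P & f = genfun P]].
Arguments BD F : clear implicits.

Definition q_linear (F : fieldType) (q : nat) (e : {poly F}) : Prop :=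
  exists (N : nat) (c : nat -> F), e = \sum_(n < N) c n *: 'X^(q ^ n).

Definition digit_seq (F : fieldType) (q : nat) (E : nat -> {poly F}) :
    nat -> {poly F} :=
  fun i => \prod_(t < i) E t ^+ qdigit q i t.

Definition BDq0 (F : fieldType) (q : nat) : set (dseries F) :=
  [set f | exists E : nat -> {poly F},
    (forall t, q_linear q (E t)) /\ f = genfun (digit_seq q E)].
Arguments BDq0 F q : clear implicits.

(* Main.v *)
Require Import Defs.
From mathcomp Require Import all_boot all_algebra all_field.
From mathcomp Require Import classical_sets.
From mathcomp Require Import boolp fsbigop.

(** Put [s = sigma_*], a bijection of the nonnegative integers that permutes
    q-adic digits, so that [sigma_*] sends the coefficient sequence [a] to
    [a \o s^-1].  Lucas' theorem in base q gives, in [F],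
    [C(n, i) = \prod_t C(n_t, i_t)].  Hence [C(s n, s i) = C(n, i)] in [F], and
    when this is nonzero every [i_t <= n_t], so that [n - i] is computed
    digitwise and [s n - s i = s (n - i)].  Reindexing the binomial sum along
    [s] therefore turns the Binomial Theorem for [P] into the one for [P \o s].
    On [BDq0], precomposing with [s] permutes the sequence [E]. *)

Set Implicit Arguments.
Unset Strict Implicit.
Unset Printing Implicit Defensive.

Import GRing.Theory.

Local Open Scope classical_set_scope.
Local Open Scope ring_scope.

(** Both sides run over the support of [G], which [f] carries bijectively from one index range to
    the other. The bounds [A] and [B] need not be related, because digit positions are cut off at
    different places before and after a permutation. *)
Lemma big_ord_reindex_bij (R : eqType) (idx : R) (op : Monoid.com_law idx)
    (f g : nat -> nat) (G : nat -> R) (A B : nat) :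
  cancel f g -> cancel g f ->
  (forall t, (A <= t)%N -> G t = idx) ->
  (forall u, (B <= u)%N -> G (f u) = idx) ->
  \big[op/idx]_(t < A) G t = \big[op/idx]_(u < B) G (f u).
Proof.
move=> fK gK GA GB.
have big_supp (H : nat -> R) (n : nat) : \big[op/idx]_(i < n) H i =
    \big[op/idx]_(i <- [seq i <- iota 0 n | H i != idx]) H i.
  rewrite big_filter -(big_mkord xpredT H) /index_iota subn0.
  rewrite (bigID (fun i => H i != idx)) /= [X in op _ X]big1 ?Monoid.mulm1 //.
  by move=> i; rewrite negbK => /eqP.
rewrite big_supp [RHS](big_supp (G \o f)) -(big_map f xpredT G); apply: perm_big.
apply: uniq_perm; first by rewrite filter_uniq ?iota_uniq.
  by rewrite (map_inj_uniq (can_inj fK)) filter_uniq ?iota_uniq.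
move=> t; rewrite -[t]gK (mem_map (can_inj fK)) !mem_filter !mem_iota !add0n /=.
(* Where [G] is not [idx], the contrapositives of [GA] and [GB] put the index in both ranges. *)
case: (eqVneq (G (f (g t))) idx) => //= GN.
have [/GA E|_] := leqP A (f (g t)); first by rewrite E eqxx in GN.
by have [/GB E|_] := leqP B (g t); first by rewrite E eqxx in GN.
Qed.

(** * Base-q digits and their permutation *)

Section Digits.
Variable q : nat.
Hypothesis q_gt1 : (1 < q)%N.

Let q_gt0 : (0 < q)%N. Proof. exact: ltnW. Qed.

Lemma qdigit0 i : qdigit q i 0 = (i %% q)%N.
Proof. by rewrite /qdigit expn0 divn1. Qed.

Lemma qdigitS i t : qdigit q i t.+1 = qdigit q (i %/ q) t.
Proof. by rewrite /qdigit expnS divnMA. Qed.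

Lemma ltn_qdigit i t : (qdigit q i t < q)%N.
Proof. exact: ltn_pmod. Qed.

Lemma qdigit_small i t : (i <= t)%N -> qdigit q i t = 0%N.
Proof.
move=> it; rewrite /qdigit divn_small ?mod0n //.
exact: leq_ltn_trans it (ltn_expl _ q_gt1).
Qed.

Lemma qdigit_expansion T i : (i < q ^ T)%N ->
  i = (\sum_(t < T) qdigit q i t * q ^ t)%N.
Proof.
elim: T i => [|T IH] i.
  by rewrite expn0 ltnS leqn0 big_ord0 => /eqP.
move=> iT; rewrite big_ord_recl qdigit0 expn0 muln1.
have /IH E : (i %/ q < q ^ T)%N by rewrite ltn_divLR // -expnSr.
rewrite {1}(divn_eq i q) {1}E addnC big_distrl /=; congr (_ + _)%N.
by apply: eq_bigr => t _; rewrite /bump add1n qdigitS expnSr mulnA.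
Qed.

(** Uniqueness of the q-adic expansion: splitting off [c 0] as the remainder modulo [q] leaves a
    shorter expansion as the quotient. *)
Lemma qdigit_sum T (c : nat -> nat) u : (forall t, (c t < q)%N) ->
  qdigit q (\sum_(t < T) c t * q ^ t) u = if (u < T)%N then c u else 0%N.
Proof.
elim: T c u => [|T IH] c u c_lt.
  by rewrite big_ord0 /qdigit div0n mod0n.
have -> : (\sum_(t < T.+1) c t * q ^ t = (\sum_(t < T) c t.+1 * q ^ t) * q + c 0)%N.
  rewrite big_ord_recl expn0 muln1 addnC big_distrl /=; congr (_ + _)%N.
  by apply: eq_bigr => t _; rewrite /bump add1n expnSr mulnA.
case: u => [|u]; first by rewrite qdigit0 modnMDl modn_small.
rewrite qdigitS divnMDl // (divn_small (c_lt 0%N)) addn0.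
by rewrite (IH (fun t => c t.+1)).
Qed.

Lemma qdigit_inj i j : (forall t, qdigit q i t = qdigit q j t) -> i = j.
Proof.
move=> E; pose T := (i + j)%N.
have iT : (i < q ^ T)%N by exact: leq_ltn_trans (leq_addr j i) (ltn_expl _ q_gt1).
have jT : (j < q ^ T)%N by exact: leq_ltn_trans (leq_addl i j) (ltn_expl _ q_gt1).
rewrite [LHS](qdigit_expansion iT) [RHS](qdigit_expansion jT).
by apply: eq_bigr => t _; rewrite E.
Qed.

(** Subtraction without borrowing: the number [k] whose digits are the differences satisfies
    [n = i + k]. *)
Lemma qdigitB n i : (forall t, (qdigit q i t <= qdigit q n t)%N) ->
  (i <= n)%N /\ forall t, qdigit q (n - i) t = (qdigit q n t - qdigit q i t)%N.
Proof.
move=> le_in; pose T := (n + i)%N.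
have nT : (n < q ^ T)%N by exact: leq_ltn_trans (leq_addr i n) (ltn_expl _ q_gt1).
have iT : (i < q ^ T)%N by exact: leq_ltn_trans (leq_addl n i) (ltn_expl _ q_gt1).
pose k := (\sum_(t < T) (qdigit q n t - qdigit q i t) * q ^ t)%N.
have En : n = (i + k)%N.
  rewrite [LHS](qdigit_expansion nT) [X in (X + _)%N](qdigit_expansion iT) -big_split /=.
  by apply: eq_bigr => t _; rewrite -mulnDl subnKC.
split=> [|u]; first by rewrite En leq_addr.
have -> : (n - i = k)%N by rewrite {1}En addKn.
rewrite /k (@qdigit_sum T (fun t => qdigit q n t - qdigit q i t)%N); last first.
  by move=> t; exact: leq_ltn_trans (leq_subr _ _) (ltn_qdigit _ _).
case: ltnP => // Tu.
by rewrite (@qdigit_small n) // (leq_trans _ Tu) // leq_addr.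
Qed.

Section Permutation.
Variables sigma tau : nat -> nat.
Hypotheses (sigmaK : cancel sigma tau) (tauK : cancel tau sigma).

Lemma qdigit_perm i u : qdigit q (digit_perm q sigma i) u = qdigit q i (tau u).
Proof.
(* [B] exceeds [sigma t] for every position [t < i], the only positions where [i] can have a nonzero
   digit. *)
pose B := (\max_(t < i) (sigma t).+1)%N.
have qdB v : (B <= v)%N -> qdigit q i (tau v) = 0%N.
  move=> Bv; apply: qdigit_small; rewrite leqNgt; apply/negP => vi.
  have := leq_bigmax (F := fun t : 'I_i => (sigma t).+1) (Ordinal vi).
  by rewrite /= tauK => /leq_trans/(_ Bv); rewrite ltnn.
have -> : digit_perm q sigma i = (\sum_(v < B) qdigit q i (tau v) * q ^ v)%N.
  rewrite /digit_perm.
  rewrite (@big_ord_reindex_bij _ _ _ _ _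
    (fun t => qdigit q i t * q ^ sigma t)%N _ B tauK sigmaK).
  - by apply: eq_bigr => v _; rewrite tauK.
  - by move=> t /qdigit_small ->.
  - by move=> v /qdB ->.
rewrite (@qdigit_sum _ (fun v => qdigit q i (tau v))) => [|t].
  by case: ltnP => // /qdB.
exact: ltn_qdigit.
Qed.

End Permutation.

Lemma digit_permK (sigma tau : nat -> nat) : cancel sigma tau ->
  cancel tau sigma -> cancel (digit_perm q sigma) (digit_perm q tau).
Proof.
move=> sK tK i; apply: qdigit_inj => t.
by rewrite (qdigit_perm tK sK) (qdigit_perm sK tK) sK.
Qed.

Lemma digit_permB (sigma tau : nat -> nat) n i : cancel sigma tau ->
  cancel tau sigma -> (forall t, (qdigit q i t <= qdigit q n t)%N) ->
  (digit_perm q sigma n - digit_perm q sigma i = digit_perm q sigma (n - i))%N.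
Proof.
move=> sK tK le_in; apply: qdigit_inj => t.
have [|_ ->] := @qdigitB (digit_perm q sigma n) (digit_perm q sigma i).
  by move=> u; rewrite !(qdigit_perm sK tK).
by have [_ E] := qdigitB le_in; rewrite !(qdigit_perm sK tK) E.
Qed.

(** The exponent of [E (sigma u)] on the left is the digit of [n] at [u], so only the order of the
    factors changes. *)
Lemma digit_seq_perm (F : fieldType) (sigma tau : nat -> nat)
    (E : nat -> {poly F}) n : cancel sigma tau -> cancel tau sigma ->
  digit_seq q E (digit_perm q sigma n) = digit_seq q (E \o sigma) n.
Proof.
move=> sK tK; rewrite /digit_seq.
rewrite (@big_ord_reindex_bij _ _ _ _ _
  (fun t => E t ^+ qdigit q (digit_perm q sigma n) t) _ n sK tK).
- by apply: eq_bigr => u _; rewrite (qdigit_perm sK tK) sK.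
- by move=> t /qdigit_small ->.
- by move=> u; rewrite (qdigit_perm sK tK) sK => /qdigit_small ->.
Qed.

(** The fibre over [n] is a single point, so the sum defining the coefficient has one term. *)
Lemma dseries_permE (F : fieldType) (sigma tau : nat -> nat) (a : dseries F) n :
  cancel sigma tau -> cancel tau sigma ->
  dseries_perm q sigma a n = a (digit_perm q tau n).
Proof.
move=> sK tK; rewrite /dseries_perm.
have -> : [set i | digit_perm q sigma i = n] = [set digit_perm q tau n].
  apply/seteqP; split=> i /= => [<-|->].
    by rewrite (digit_permK sK tK).
  by rewrite (digit_permK tK sK).
by rewrite fsbig_set1.
Qed.

End Digits.

(** * Lucas' theorem in base q *)

Section Lucas.
Variables (R : comNzRingType) (p lambda : nat).
Hypotheses (pcharR : p \in [pchar R]) (lambda_gt0 : (0 < lambda)%N).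
Let q := (p ^ lambda)%N.

Let q_gt1 : (1 < q)%N.
Proof.
have := ltn_expl lambda (prime_gt1 (pcharf_prime pcharR)).
exact: leq_ltn_trans.
Qed.

Lemma coef_Xadd1_exp n i : (('X + 1) ^+ n : {poly R})`_i = 'C(n, i)%:R.
Proof.
rewrite exprD1n coef_sum.
under eq_bigr do rewrite coefMn coefXn.
have [le_in|lt_ni] := leqP i n.
  rewrite (bigD1 (inord i)) //= inordK // eqxx big1 ?addr0 // => j /eqP ji.
  case: eqP => [E|]; last by rewrite mul0rn.
  by case: ji; apply: val_inj; rewrite /= inordK.
rewrite bin_small // big1 // => j _; case: eqP => [E|]; last by rewrite mul0rn.
by have := leq_ltn_trans (ltn_ord j : j <= n)%N lt_ni; rewrite E ltnn.
Qed.

(** Compare the coefficients of ['X^i] in [(X + 1)^n = (X^q + 1)^(n %/ q) * (X + 1)^(n %% q)], which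
    holds by Frobenius. *)
Lemma bin_lucas_step n i :
  'C(n, i)%:R = 'C(n %% q, i %% q)%:R * 'C(n %/ q, i %/ q)%:R :> R.
Proof.
have q_gt0 : (0 < q)%N by exact: ltnW.
have Xq : ('X + 1) ^+ q = 'X^q + 1 :> {poly R}.
  rewrite exprDn_pchar ?expr1n // /q pnatX pnatE ?(pcharf_prime pcharR) //.
  by rewrite pchar_poly pcharR.
rewrite -[LHS]coef_Xadd1_exp {1}(divn_eq n q) exprD mulnC exprM Xq exprD1n.
rewrite mulr_suml coef_sum.
(* A nonzero term needs [0 <= i - q * k <= n %% q < q], which forces [k = i %/ q]. *)
have termE (k : nat) :
    (('X^q ^+ k *+ 'C(n %/ q, k)) * ('X + 1) ^+ (n %% q) : {poly R})`_i =
    if k == (i %/ q)%N then 'C(n %% q, i %% q)%:R * 'C(n %/ q, i %/ q)%:R else 0.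
  rewrite -exprM mulrnAl coefMn coefXnM; case: (ltngtP k (i %/ q)) => [ki|ik|->].
  - rewrite ltnNge mulnC -leq_divRL // (ltnW ki) /= coef_Xadd1_exp bin_small.
      by rewrite mul0rn.
    apply: leq_trans (ltn_pmod n q_gt0) _.
    rewrite leq_subRL; first by rewrite -mulSnr -leq_divRL.
    by rewrite -leq_divRL // ltnW.
  - by rewrite mulnC -ltn_divLR // ik mul0rn.
  - rewrite mulnC ltnNge leq_trunc_div /= coef_Xadd1_exp mulr_natr.
    by rewrite {1}(divn_eq i q) addKn.
under eq_bigr do rewrite termE.
(* If [i %/ q] lies beyond the summation range, no term survives, and ['C(n %/ q, i %/ q)] is 0 as
   well. *)
have [lt_ic|le_ci] := leqP (n %/ q).+1 (i %/ q).
  rewrite [X in _ * X%:R]bin_small // mulr0 big1 // => k _.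
  by case: eqP.
rewrite (bigD1 (Ordinal le_ci)) //= eqxx big1 ?addr0 // => k /eqP ki.
by case: eqP => // E; case: ki; apply: val_inj.
Qed.

Lemma bin_lucas T n i : (n < q ^ T)%N -> (i < q ^ T)%N ->
  'C(n, i)%:R = \prod_(t < T) 'C(qdigit q n t, qdigit q i t)%:R :> R.
Proof.
have q_gt0 : (0 < q)%N by exact: ltnW.
elim: T n i => [|T IH] n i.
  by rewrite !ltnS !leqn0 => /eqP-> /eqP->; rewrite big_ord0.
move=> nT iT; rewrite big_ord_recl !qdigit0 bin_lucas_step; congr (_ * _).
rewrite IH ?ltn_divLR -?expnSr //.
by apply: eq_bigr => t _; rewrite !lift0 !qdigitS.
Qed.

(** The Lucas product is unchanged when the digits of [n] and [i] are permuted simultaneously. *)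
Lemma bin_digit_perm (sigma tau : nat -> nat) n i :
  cancel sigma tau -> cancel tau sigma ->
  'C(digit_perm q sigma n, digit_perm q sigma i)%:R = 'C(n, i)%:R :> R.
Proof.
move=> sK tK; have lt_exp m T : (m <= T)%N -> (m < q ^ T)%N.
  by move/leq_ltn_trans; apply; exact: ltn_expl.
set m := digit_perm q sigma n; set j := digit_perm q sigma i.
rewrite (@bin_lucas (m + j)) ?lt_exp ?leq_addr ?leq_addl //.
rewrite (@bin_lucas (n + i)) ?lt_exp ?leq_addr ?leq_addl //.
rewrite (@big_ord_reindex_bij _ _ _ _ _
  (fun t => 'C(qdigit q m t, qdigit q j t)%:R : R) _ (n + i) sK tK).
- by apply: eq_bigr => t _; rewrite !(qdigit_perm q_gt1 sK tK) sK.
- move=> t mjt; rewrite !(qdigit_small q_gt1) //.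
    exact: leq_trans (leq_addl _ _) mjt.
  exact: leq_trans (leq_addr _ _) mjt.
- move=> t nit; rewrite !(qdigit_perm q_gt1 sK tK) sK !(qdigit_small q_gt1) //.
    exact: leq_trans (leq_addl _ _) nit.
  exact: leq_trans (leq_addr _ _) nit.
Qed.

(** A digit of [i] larger than that of [n] would make one Lucas factor vanish. *)
Lemma bin_neq0_leq_qdigit n i : 'C(n, i)%:R != 0 :> R ->
  forall t, (qdigit q i t <= qdigit q n t)%N.
Proof.
move=> C0 t; have [lt_t|ge_t] := ltnP t (n + i); last first.
  by rewrite (qdigit_small q_gt1) // (leq_trans (leq_addl n i)).
have lt_exp m T : (m <= T)%N -> (m < q ^ T)%N.
  by move/leq_ltn_trans; apply; exact: ltn_expl.
rewrite leqNgt; apply: contraNN C0 => lt_ni.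
rewrite (@bin_lucas (n + i)) ?lt_exp ?leq_addr ?leq_addl //.
by rewrite (bigD1 (Ordinal lt_t)) //= bin_small // mul0r.
Qed.

End Lucas.

(** * Stability of both sets of generating functions *)

Section Stability.
Variables (F : fieldType) (p lambda : nat).
Hypotheses (pcharF : p \in [pchar F]) (lambda_gt0 : (0 < lambda)%N).
Let q := (p ^ lambda)%N.

Let q_gt1 : (1 < q)%N.
Proof.
have := ltn_expl lambda (prime_gt1 (pcharf_prime pcharF)).
exact: leq_ltn_trans.
Qed.

Lemma binomial_theorem_digit_perm (sigma tau : nat -> nat) (P : nat -> {poly F}) :
  cancel sigma tau -> cancel tau sigma ->
  binomial_theorem P ->
  binomial_theorem (P \o digit_perm q sigma).
Proof.
move=> sigmaK tauK bP n; rewrite /= bP.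
(* The Binomial Theorem is an identity in F[x][y], so Lucas' theorem is applied in that ring. *)
have pcharFF : p \in [pchar {poly {poly F}}] by rewrite !pchar_poly.
have sK := digit_permK q_gt1 sigmaK tauK.
have tK := digit_permK q_gt1 tauK sigmaK.
set m := digit_perm q sigma n.
rewrite (@big_ord_reindex_bij _ _ _ _ _ (fun j =>
  'C(m, j)%:R * (P j)%:P * map_poly polyC (P (m - j)%N)) _ n.+1 sK tK).
- apply: eq_bigr => i _.
  rewrite (bin_digit_perm pcharFF lambda_gt0 _ _ sigmaK tauK).
  (* With a zero coefficient the two terms agree whatever the remaining indices are; otherwise
     subtraction commutes with the digit permutation. *)
  have [->|C0] := eqVneq ('C(n, i)%:R : {poly {poly F}}) 0; first by rewrite !mul0r.
  have le_in := bin_neq0_leq_qdigit pcharFF lambda_gt0 C0.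
  by rewrite (digit_permB q_gt1 sigmaK tauK le_in).
- by move=> j mj; rewrite bin_small // !mul0r.
- move=> i ni; rewrite (bin_digit_perm pcharFF lambda_gt0 _ _ sigmaK tauK).
  by rewrite bin_small // !mul0r.
Qed.

Lemma dseries_permK (sigma tau : nat -> nat) :
  cancel sigma tau -> cancel tau sigma ->
  cancel (@dseries_perm F q sigma) (dseries_perm q tau).
Proof.
move=> sigmaK tauK a; apply/funext => n.
rewrite (dseries_permE q_gt1 _ _ tauK sigmaK) (dseries_permE q_gt1 _ _ sigmaK tauK).
by rewrite (digit_permK q_gt1 sigmaK tauK).
Qed.

Lemma dseries_perm_BD (sigma tau : nat -> nat) a :
  cancel sigma tau -> cancel tau sigma ->
  BD F a -> BD F (dseries_perm q sigma a).
Proof.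
move=> sigmaK tauK [P [bP [i Pi] ->]]; exists (P \o digit_perm q tau); split.
- exact: binomial_theorem_digit_perm tauK sigmaK bP.
- by exists (digit_perm q sigma i); rewrite /= (digit_permK q_gt1 sigmaK tauK).
- by apply/funext => n; rewrite (dseries_permE q_gt1 _ _ sigmaK tauK).
Qed.

Lemma dseries_perm_BDq0 (sigma tau : nat -> nat) a :
  cancel sigma tau -> cancel tau sigma ->
  BDq0 F q a -> BDq0 F q (dseries_perm q sigma a).
Proof.
move=> sigmaK tauK [E [linE ->]]; exists (E \o tau); split=> [t|]; first exact: linE.
apply/funext => n; rewrite (dseries_permE q_gt1 _ _ sigmaK tauK) /genfun.
by rewrite (digit_seq_perm q_gt1 E n tauK sigmaK).
Qed.

End Stability.

(** Reduces equality with the image to inclusions, to be shown for [sigma] and for its inverse. *)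
Lemma image_id_of_stable (T : Type) (f g : T -> T) (A : set T) :
  cancel g f -> (forall a, A a -> A (f a)) -> (forall a, A a -> A (g a)) ->
  f @` A = A.
Proof.
move=> gK fA gA; apply/seteqP; split=> [_ [a Aa <-]|a Aa]; first exact: fA.
by exists (g a); [exact: gA | exact: gK].
Qed.

Theorem proposition8 (p lambda q : nat) (p_prime : prime p)
    (lambda_ge1 : (1 <= lambda)%N) (q_def : q = (p ^ lambda)%N)
    (Fq : finFieldType) (card_Fq : #|Fq| = q)
    (F : fieldType) (iota : {rmorphism Fq -> F})
    (sigma : nat -> nat) (sigma_perm : bijective sigma) :
  dseries_perm q sigma @` BD F = BD F /\
  dseries_perm q sigma @` BDq0 F q = BDq0 F q.
Proof.
subst q; case: sigma_perm => tau sigmaK tauK.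
(* The characteristic of [Fq] is read off its cardinality and transported along [iota]. *)
have pcharF : p \in [pchar F].
  exact: rmorph_pchar iota _ (card_finPcharP card_Fq p_prime).
have permK := dseries_permK pcharF lambda_ge1 tauK sigmaK.
split; apply: image_id_of_stable permK _ _ => a.
- exact (dseries_perm_BD pcharF lambda_ge1 sigmaK tauK).
- exact (dseries_perm_BD pcharF lambda_ge1 tauK sigmaK).
- exact (dseries_perm_BDq0 pcharF lambda_ge1 sigmaK tauK).
- exact (dseries_perm_BDq0 pcharF lambda_ge1 tauK sigmaK).
Qed.
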